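(* Let $A$ be an invertible symmetric complex $n\times n$ matrix and $P(z)\in\mathcal{A}_n$ any homogeneous polynomial of degree $d\ge2$. Then $P(z)$ is $\Delta_A$-nilpotent if and only if, for every $\beta\in\mathbb{C}^n$, the polynomial $\beta_D^{\,d-2}P(z)$ is $\Delta_A$-nilpotent.
   Context: $\mathcal{A}_n=\mathbb{C}[z_1,\dots,z_n]$, $D_i=\partial/\partial z_i$, $\Delta_A=\sum_{i,j=1}^n a_{ij}D_iD_j$ for $A=(a_{ij})$. For $\beta=(\beta_1,\dots,\beta_n)\in\mathbb{C}^n$, $\beta_D:=\langle\beta,D\rangle=\sum_{i=1}^n\beta_iD_i$. A polynomial $Q$ is $\Delta_A$-nilpotent if $\Delta_A^m(Q^m)=0$ for all $m\ge1$. *)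

(* Defs.v *)
From mathcomp Require Import all_boot all_algebra.
From mathcomp Require Import complex reals.
From mathcomp Require Import mpoly.

Set Implicit Arguments.
Unset Strict Implicit.
Unset Printing Implicit Defensive.

Import GRing.Theory.
Local Open Scope ring_scope.

Definition laplacian (K : comNzRingType) (n : nat) (A : 'M[K]_n)
    (p : {mpoly K[n]}) : {mpoly K[n]} :=
  \sum_(i < n) \sum_(j < n) A i j *: p^`M(j)^`M(i).

Definition dirderiv (K : comNzRingType) (n : nat) (b : 'rV[K]_n)
    (p : {mpoly K[n]}) : {mpoly K[n]} :=
  \sum_(i < n) b 0 i *: p^`M(i).

Definition laplacian_nilpotent (K : comNzRingType) (n : nat) (A : 'M[K]_n)
    (q : {mpoly K[n]}) : Prop :=
  forall m : nat, (1 <= m)%N -> iter m (laplacian A) (q ^+ m) = 0.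

(* Main.v *)
Require Import Defs.
From HB Require Import structures.
From mathcomp Require Import all_boot all_algebra.
From mathcomp Require Import complex reals.
From mathcomp Require Import mpoly.
From mathcomp Require Import ring.

Set Implicit Arguments.
Unset Strict Implicit.
Unset Printing Implicit Defensive.

Import GRing.Theory.
Local Open Scope ring_scope.

(** Let [w = \sum_k w_k s^k] be the power series in [s] with [w_0 = P] solving
    the Hamilton-Jacobi equation [dw/ds = <grad w, A grad w>], and let
    [H = A * Hess w].  Two computations carry the proof.
    - As long as [Delta_A w = 0], [w] also solves the heat-type equation
      [Delta_A (w^(r+1)) = (r+1) d(w^r)/ds], hence by induction on [k]
      [r! Delta_A^k (P^(k+r)) = k! (k+r)! [s^k] w^r].  Taking [r = 1] shows that
      [P] is [Delta_A]-nilpotent iff [Delta_A w = 0].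
    - [d(tr H^k)/ds = 2 k tr H^(k+1) + 2 <A grad w, grad (tr H^k)>] and
      [tr H = Delta_A w], so [Delta_A w = 0] iff [tr (A Hess P)^k = 0] for all
      [k >= 1].
    So [P] is [Delta_A]-nilpotent iff the traces of all powers of
    [A Hess P(x)] vanish at every point [x].  For [P] homogeneous of degree [d],
    the Hessian of [beta_D^(d-2) P] is constant, equal to
    [(d-2)! Hess P(beta)], and the theorem follows.  *)

(** * Derivations of a commutative ring, and their action on traces of matrix powers *)

Definition leibniz (S : comNzRingType) (D : S -> S) :=
  forall x y, D (x * y) = D x * y + x * D y.

Section Derivations.
Variable S : comNzRingType.

Lemma leibniz_mulmx (D : {additive S -> S}) m n p
    (M : 'M[S]_(m, n)) (N : 'M[S]_(n, p)) :
  leibniz D -> map_mx D (M *m N) = map_mx D M *m N + M *m map_mx D N.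
Proof.
move=> LD; apply/matrixP=> i j; rewrite !mxE raddf_sum -big_split /=.
by apply: eq_bigr => k _; rewrite !mxE LD.
Qed.

Lemma leibniz1 (D : {additive S -> S}) : leibniz D -> D 1 = 0.
Proof.
move=> LD; have /eqP := LD 1 1; rewrite !mulr1 mul1r -subr_eq0.
by rewrite opprD addrA subrr sub0r oppr_eq0 => /eqP.
Qed.

Lemma leibniz_exp (D : {additive S -> S}) f r :
  leibniz D -> D (f ^+ r.+1) = f ^+ r * D f *+ r.+1.
Proof.
move=> LD; elim: r => [|r IH]; first by rewrite expr1 expr0 mul1r.
by rewrite exprS LD IH mulrnAr mulrA -exprS [D f * _]mulrC -mulrS.
Qed.

(** The product rule yields [k.+1] terms, and cyclicity of the trace makes them all equal. *)
Lemma leibniz_trace_exp (D : {additive S -> S}) n (M : 'M[S]_n) k :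
  leibniz D -> D (\tr (M ^+ k.+1)) = \tr (M ^+ k *m map_mx D M) *+ k.+1.
Proof.
move=> LD.
have D1 : map_mx D (1 : 'M[S]_n) = 0.
  apply/matrixP => i j; rewrite !mxE; case: (i == j); last by rewrite raddf0.
  exact: leibniz1.
have raddf_tr (N : 'M[S]_n) : D (\tr N) = \tr (map_mx D N).
  by rewrite /mxtrace raddf_sum; apply: eq_bigr => i _; rewrite mxE.
(* The prefix [M ^+ j] is what the induction needs: it absorbs the factor [M] split off on the
   left. *)
have gen j : \tr (M ^+ j *m map_mx D (M ^+ k.+1)) = \tr (M ^+ (j + k) *m map_mx D M) *+ k.+1.
  elim: k j => [|k IH] j; first by rewrite addn0 expr1.
  rewrite exprS -[M * _]/(M *m _) leibniz_mulmx // mulmxDr mxtraceD.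
  rewrite [in X in _ + X]mulmxA -[M ^+ j *m M]/(M ^+ j * M) -exprSr IH.
  rewrite mulmxA mxtrace_mulC mulmxA -[M ^+ k.+1 *m _]/(_ * _) -exprD.
  by rewrite addnC addSnnS -mulrS.
by rewrite raddf_tr -(mul1mx (map_mx _ _)) -[1%:M]/(M ^+ 0) gen.
Qed.

(** * Hamilton-Jacobi evolution, with commuting derivations [D i] (space) and [T] (time) that kill
    [A] *)

Section Evolution.
Variables (n : nat) (A : 'M[S]_n) (D : 'I_n -> {additive S -> S}).
Variable T : {additive S -> S}.
Hypothesis A_sym : A^T = A.
Hypothesis LD : forall i, leibniz (D i).
Hypothesis LT : leibniz T.
Hypothesis DD : forall i j f, D i (D j f) = D j (D i f).
Hypothesis DT : forall i f, D i (T f) = T (D i f).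
Hypothesis DA : forall k i j, D k (A i j) = 0.
Hypothesis TA : forall i j, T (A i j) = 0.

Definition hess f : 'M[S]_n := \matrix_(i, j) D i (D j f).
Definition gradform f g : S := \sum_i \sum_j A i j * (D j f * D i g).
Definition lap f : S := \sum_i \sum_j A i j * D i (D j f).

Lemma trace_hess f : \tr (A *m hess f) = lap f.
Proof.
apply: eq_bigr => i _; rewrite mxE; apply: eq_bigr => j _.
by rewrite mxE DD.
Qed.

Lemma gradformC f g : gradform f g = gradform g f.
Proof.
rewrite /gradform exchange_big; apply: eq_bigr => i _; apply: eq_bigr => j _.
by rewrite -[in A j i]A_sym mxE [X in _ * X]mulrC.
Qed.

Lemma leibniz_gradform f g k :
  D k (gradform f g) = gradform (D k f) g + gradform f (D k g).
Proof.
rewrite /gradform raddf_sum -big_split; apply: eq_bigr => i _.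
rewrite raddf_sum -big_split; apply: eq_bigr => j _.
by rewrite LD DA mul0r add0r LD mulrDr DD [D k (D i g)]DD.
Qed.

Lemma gradform_Dr f : additive (gradform f).
Proof.
move=> g h; rewrite /gradform -sumrB; apply: eq_bigr => i _.
by rewrite -sumrB; apply: eq_bigr => j _; rewrite raddfB !mulrBr.
Qed.

HB.instance Definition _ f :=
  GRing.isZmodMorphism.Build S S (gradform f) (gradform_Dr f).

(** [gradform f] differentiates along the vector field [A grad f], so the rules for powers and
    traces apply to it as they do to [T]. *)
Lemma leibniz_gradformr f : leibniz (gradform f).
Proof.
move=> x y; rewrite /gradform mulr_suml mulr_sumr -big_split.
apply: eq_bigr => i _; rewrite mulr_suml mulr_sumr -big_split.
apply: eq_bigr => j _; rewrite /= LD.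
by rewrite -!mulrA [x * (A i j * _)]mulrCA [x * (D j f * _)]mulrCA -!mulrDr.
Qed.

(** The two derivatives either fall on different factors, giving the matrix product, or on the same
    one, giving the transport term; symmetry of the form doubles each. *)
Lemma hess_gradform w :
  hess (gradform w w) =
    (hess w *m (A *m hess w) + map_mx (gradform w) (hess w)) *+ 2.
Proof.
apply/matrixP => i j; rewrite mulmxnE mxE leibniz_gradform gradformC -mulr2n.
rewrite raddfMn leibniz_gradform; congr (_ *+ 2).
rewrite mulmxA 2!mxE [map_mx _ _ _ _]mxE [hess w i j]mxE gradformC.
congr (_ + _); rewrite /gradform exchange_big; apply: eq_bigr => k _.
rewrite mxE mulr_suml; apply: eq_bigr => l _.
by rewrite !mxE [D i (D l w)]DD; ring.
Qed.

(** The last summand is the error term when [w] solves [T w = gradform w w] only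
    approximately. *)
Lemma trace_evolution w k (H := A *m hess w) :
  T (\tr (H ^+ k.+1)) =
    (\tr (H ^+ k.+2) *+ k.+1 + gradform w (\tr (H ^+ k.+1))) *+ 2
    + \tr (H ^+ k *m (A *m hess (T w - gradform w w))) *+ k.+1.
Proof.
have hessT : hess (T w) = map_mx T (hess w).
  by apply/matrixP => i j; rewrite !mxE !DT.
have hessB f g : hess (f - g) = hess f - hess g.
  by apply/matrixP => i j; rewrite !mxE !raddfB.
have TH : map_mx T H = A *m hess (T w).
  rewrite leibniz_mulmx // hessT.
  suff -> : map_mx T A = 0 by rewrite mul0mx add0r.
  by apply/matrixP => i j; rewrite !mxE TA.
have GH : map_mx (gradform w) H = A *m map_mx (gradform w) (hess w).
  rewrite leibniz_mulmx; last exact: leibniz_gradformr.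
  suff -> : map_mx (gradform w) A = 0 by rewrite mul0mx add0r.
  apply/matrixP => i j; rewrite !mxE /gradform big1 // => a _.
  by rewrite big1 // => b _; rewrite DA !mulr0.
rewrite (leibniz_trace_exp _ _ LT).
rewrite (leibniz_trace_exp _ _ (@leibniz_gradformr w)).
rewrite hessB hess_gradform TH GH.
have -> : H ^+ k.+2 = H ^+ k *m (A *m (hess w *m H)).
  by rewrite (mulmxA A) -/H !exprSr -mulrA.
rewrite mulr2n (mulr2n (_ + map_mx _ _)) !(mulmxBr, mulmxDr, mxtraceD).
have trN (M : 'M[S]_n) : \tr (- M) = - \tr M by exact: raddfN.
rewrite trN !mxtraceD -/H.
by move: (\tr _) (\tr _) (\tr _) => a b c; ring.
Qed.

(** The product rule gives [gradform w (w ^+ r)], which differs from [T (w ^+ r)] by a multiple of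
    the Hamilton-Jacobi defect. At [r = 0] the truncated [r.-1] is harmless, its coefficient being
    zero. *)
Lemma lap_exp w r :
  lap (w ^+ r.+1) = (T (w ^+ r) + w ^+ r * lap w) *+ r.+1
    - (w ^+ r.-1 * (T w - gradform w w)) *+ (r * r.+1).
Proof.
have DDw i j : D i (D j (w ^+ r.+1)) =
    (D i (w ^+ r) * D j w + w ^+ r * D i (D j w)) *+ r.+1.
  by rewrite leibniz_exp // raddfMn LD.
have -> : lap (w ^+ r.+1) = (gradform w (w ^+ r) + w ^+ r * lap w) *+ r.+1.
  rewrite /lap /gradform mulr_sumr -big_split -sumrMnl.
  apply: eq_bigr => i _; rewrite mulr_sumr -big_split -sumrMnl.
  apply: eq_bigr => j _; rewrite DDw /=; ring.
case: r {DDw} => [|r].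
  rewrite mul0n mulr0n subr0 expr0 (leibniz1 LT).
  by rewrite (leibniz1 (@leibniz_gradformr w)).
rewrite (leibniz_exp _ _ LT) (leibniz_exp _ _ (@leibniz_gradformr w)) /=.
ring.
Qed.

End Evolution.
End Derivations.

(** * Truncated power series *)

(** Power series in [s] are replaced by polynomials in [s] modulo [s^N]:
    [vanish N f] stands for [f = O(s^N)]. *)
Definition vanish (S : nzRingType) (N : nat) (f : {poly S}) :=
  forall i, (i < N)%N -> f`_i = 0.

Section Vanish.
Variable S : comNzRingType.
Implicit Types f g : {poly S}.

Lemma vanish_le N M f : (M <= N)%N -> vanish N f -> vanish M f.
Proof. by move=> MN Vf i iM; apply: Vf; apply: leq_trans MN. Qed.

Lemma vanishMl N f g : vanish N f -> vanish N (g * f).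
Proof.
move=> Vf i iN; rewrite coefM big1 // => j _.
by rewrite Vf ?mulr0 // (leq_ltn_trans _ iN) // leq_subr.
Qed.

Lemma vanish_map N (phi : {additive S -> S}) f :
  vanish N f -> vanish N (map_poly phi f).
Proof. by move=> Vf i iN; rewrite coef_map /= Vf ?raddf0. Qed.

Lemma vanish_sum N I (r : seq I) (F : I -> {poly S}) :
  (forall i, vanish N (F i)) -> vanish N (\sum_(i <- r) F i).
Proof. by move=> VF i iN; rewrite coef_sum big1 // => j _; apply: VF. Qed.

End Vanish.

(** * The flow started at [P], to finite order in [s] *)

Section Flow.
Variables (K : numFieldType) (n : nat) (A : 'M[K]_n).
Hypothesis A_sym : A^T = A.
Local Notation T := {mpoly K[n]}.
Local Notation S := {poly T}.

Lemma mpoly_mulrnI (p q : T) m : p *+ m.+1 = q *+ m.+1 -> p = q.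
Proof.
rewrite -!scaler_nat; apply: scalerI.
by rewrite Num.Theory.pnatr_eq0.
Qed.

(** The outer variable is [s], so space derivatives act coefficientwise, and [deriv] is the time
    derivative. *)
Definition cmderiv (i : 'I_n) : {additive S -> S} := map_poly (mderiv i).
Definition Apoly : 'M[S]_n := map_mx (polyC \o @mpolyC n K) A.

(** The defect of [w] in the Hamilton-Jacobi equation. *)
Local Notation E w := (w^`() - gradform Apoly cmderiv w w).
Local Notation lapS := (lap Apoly cmderiv).

Lemma Apoly_sym : Apoly^T = Apoly.
Proof. by rewrite /Apoly map_trmx A_sym. Qed.

Lemma leibniz_cmderiv i : leibniz (cmderiv i).
Proof.
move=> f g; apply/polyP => k; rewrite coefD !coefM coef_map /= coefM raddf_sum.
rewrite -big_split; apply: eq_bigr => j _.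
by rewrite !coef_map /= mderivM.
Qed.

Lemma leibniz_deriv : leibniz (@deriv T).
Proof. exact: derivM. Qed.

Lemma cmderivC i j f : cmderiv i (cmderiv j f) = cmderiv j (cmderiv i f).
Proof. by apply/polyP => k; rewrite !coef_map /= mderiv_comm. Qed.

Lemma cmderiv_deriv i f : cmderiv i f^`() = (cmderiv i f)^`().
Proof. by apply/polyP => k; rewrite !(coef_map, coef_deriv) /= raddfMn. Qed.

Lemma cmderiv_Apoly k i j : cmderiv k (Apoly i j) = 0.
Proof. by rewrite mxE /cmderiv /= map_polyC /= mderivC polyC0. Qed.

Lemma deriv_Apoly i j : (Apoly i j)^`() = 0.
Proof. by rewrite mxE derivC. Qed.

Lemma coef_lapS f k : (lapS f)`_k = laplacian A f`_k.
Proof.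
rewrite coef_sum; apply: eq_bigr => i _; rewrite coef_sum.
by apply: eq_bigr => j _; rewrite mxE coefCM !coef_map /= mul_mpolyC.
Qed.

Lemma laplacianMn p m : laplacian A (p *+ m) = laplacian A p *+ m.
Proof.
rewrite /laplacian -sumrMnl; apply: eq_bigr => i _.
by rewrite -sumrMnl; apply: eq_bigr => j _; rewrite !mderivMn scalerMnr.
Qed.

Lemma vanish_gradform N f g :
  vanish N g -> vanish N (gradform Apoly cmderiv f g).
Proof.
move=> Vg; apply: vanish_sum => i; apply: vanish_sum => j.
by apply: vanishMl; apply: vanishMl; apply: vanish_map.
Qed.

Lemma exists_flow N (P : T) : exists w : S, w`_0 = P /\ vanish N (E w).
Proof.
elim: N => [|N [w [w0 VE]]]; first by exists P%:P; rewrite coefC.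
(* Adding [c s^(N+1)] to [w] changes the coefficient of [s^N] in the defect by [(N+1) c]; this [c]
   cancels it. *)
pose c : T := - (N.+1%:R : K)^-1 *: (E w)`_N.
pose v : S := c%:P * 'X^(N.+1).
have Vv : vanish N.+1 v.
  by move=> i iN; rewrite coefCM coefXn ltn_eqF // mulr0.
exists (w + v); split; first by rewrite coefD w0 Vv // addr0.
have -> : E (w + v) = (E w + v^`()) - (gradform Apoly cmderiv w v +
    gradform Apoly cmderiv w v + gradform Apoly cmderiv v v).
  rewrite derivD raddfD /= [gradform _ _ (w + v) w]gradformC ?Apoly_sym //.
  rewrite [gradform _ _ (w + v) v]gradformC ?Apoly_sym // !raddfD /=.
  rewrite [gradform _ _ v w]gradformC ?Apoly_sym //; ring.
move=> i iN; have Vg f : (gradform Apoly cmderiv f v)`_i = 0.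
  exact: (vanish_gradform _ Vv).
move: (E w) VE @c @v Vv Vg => e VE c v Vv Vg.
rewrite coefB !coefD !Vg !addr0 subr0 coef_deriv coefCM coefXn eqSS.
move: iN; rewrite ltnS leq_eqVlt => /orP[/eqP -> | iN].
  rewrite eqxx mulr1 -scaler_nat scalerA mulrN mulfV ?scaleN1r ?subrr //.
  by rewrite Num.Theory.pnatr_eq0.
by rewrite VE // ltn_eqF // mulr0 mul0rn addr0.
Qed.

(** Induction on [k] for all [r] at once: the step uses the hypothesis at [r.+1], and [lap_exp]
    trades one Laplacian of [w ^+ r.+1] for a time derivative of [w ^+ r]. *)
Lemma iter_laplacian_exp N (P : T) (w : S) : w`_0 = P -> vanish N (E w) ->
  vanish N (lapS w) -> forall k r, (k <= N)%N ->
  iter k (laplacian A) (P ^+ (k + r)) *+ r`! = (w ^+ r)`_k *+ (k`! * (k + r)`!).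
Proof.
move=> w0 VE VL; elim=> [|k IH] r kN.
  rewrite /= add0n fact0 mul1n; congr (_ *+ _).
  by rewrite -!horner_coef0 horner_exp horner_coef0 w0.
have := congr1 (laplacian A) (IH r.+1 (ltnW kN)).
rewrite !laplacianMn -coef_lapS.
rewrite (lap_exp _ leibniz_cmderiv leibniz_deriv) ?cmderivC //.
rewrite coefB !coefMn coefD coef_deriv (vanishMl _ VL kN) (vanishMl _ VE kN).
rewrite mul0rn subr0 addr0.
rewrite -iterS addnS -addSn !factS => eq_k.
apply: (@mpoly_mulrnI _ _ r).
rewrite -mulrnA mulnC eq_k -!mulrnA; congr (_ *+ _).
by rewrite mulnCA !mulnA [(_ * r.+1)%N]mulnC !mulnA.
Qed.

Lemma laplacian_nilpotent_flow N (P : T) (w : S) :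
  w`_0 = P -> vanish N (E w) ->
  (forall m, (m <= N)%N -> iter m.+1 (laplacian A) (P ^+ m.+1) = 0) <->
  vanish N.+1 (lapS w).
Proof.
move=> w0 VE.
(* Taking [r = 1] and one more Laplacian: if [lapS w] vanishes below order [j], its coefficient at
   [j] is, up to a nonzero integer, the nilpotency expression of exponent [j.+1]. Coefficients are
   thus killed one at a time. *)
have step j : (j <= N)%N -> vanish j (lapS w) ->
    iter j.+1 (laplacian A) (P ^+ j.+1) = (lapS w)`_j *+ (j`! * j.+1`!).
  move=> jN VL; rewrite iterS.
  have := iter_laplacian_exp w0 (vanish_le jN VE) VL 1 (leqnn j).
  by rewrite factS fact0 mulr1n addn1 expr1 => ->; rewrite laplacianMn coef_lapS.
have fact_pos j : (j`! * j.+1`! = (j`! * j.+1`!).-1.+1)%N.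
  by rewrite prednK // muln_gt0 !fact_gt0.
split=> [nilP | VL m mN]; last first.
  by rewrite step ?VL ?mul0rn //; apply: vanish_le VL; apply: ltnW.
suff VL j : (j <= N.+1)%N -> vanish j (lapS w) by apply: VL.
elim: j => [|j IH] jN // i; rewrite ltnS leq_eqVlt => /orP[/eqP -> | ij].
  have := step j jN (IH (ltnW jN)); rewrite nilP // fact_pos => eq0.
  by apply: (mpoly_mulrnI (m := (j`! * j.+1`!).-1)); rewrite mul0rn -eq0.
by apply: IH => //; apply: ltnW.
Qed.

Local Notation H w := (Apoly *m hess cmderiv w).

Lemma trace_flow N (w : S) k : vanish N (E w) -> forall i, (i < N)%N ->
  (\tr (H w ^+ k.+1))`_i.+1 *+ i.+1 =
    ((\tr (H w ^+ k.+2))`_i *+ k.+1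
     + (gradform Apoly cmderiv w (\tr (H w ^+ k.+1)))`_i) *+ 2.
Proof.
move=> VE i iN; rewrite -coef_deriv.
rewrite (trace_evolution Apoly_sym leibniz_cmderiv leibniz_deriv cmderivC
  cmderiv_deriv cmderiv_Apoly deriv_Apoly).
rewrite coefD !coefMn coefD coefMn.
suff -> : (\tr (H w ^+ k *m H (E w)))`_i = 0 by rewrite mul0rn addr0.
apply: (vanish_sum (N := N)) => // a; rewrite mxE; apply: vanish_sum => b.
apply: vanishMl; rewrite mxE; apply: vanish_sum => c.
by apply: vanishMl; rewrite mxE; do 2 apply: vanish_map.
Qed.

Lemma vanish_lap_flow N (w : S) : vanish N (E w) ->
  vanish N.+1 (lapS w) <->
  (forall k, (k <= N)%N -> (\tr (H w ^+ k.+1))`_0 = 0).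
Proof.
move=> VE; have flow := trace_flow _ VE; split=> [VL | tr0].
  (* Each further power of [H w] costs one order in [s]; for [k <= N] at least the constant
     coefficient is still covered. *)
  suff Vtr k : (k <= N)%N -> vanish (N.+1 - k) (\tr (H w ^+ k.+1)).
    by move=> k kN; apply: Vtr; rewrite // subn_gt0.
  elim: k => [|k IH] kN; first by rewrite expr1 trace_hess //; apply: cmderivC.
  have {}IH := IH (ltnW kN); move=> i; rewrite subSS => iNk.
  have := flow k i (leq_trans iNk (leq_subr _ _)).
  rewrite IH; last by rewrite subSn // ltnW.
  have iNk1 : (i < N.+1 - k)%N by rewrite (leq_trans iNk) // leq_sub2r.
  rewrite mul0rn (vanish_gradform _ IH) // addr0.
  rewrite -mulrnA muln2 => /esym eq0.
  by apply: (@mpoly_mulrnI _ _ k.*2.+1); rewrite mul0rn -doubleS.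
(* Conversely, the evolution equation gains one order in [s] for the power [k.+1] from the power
   [k.+2], so all powers are treated together along [k + j <= N.+1]. *)
suff Vtr j k : (k + j <= N.+1)%N -> vanish j (\tr (H w ^+ k.+1)).
  by rewrite -(trace_hess _ cmderivC) -[H w]expr1; apply: Vtr.
elim: j k => [|j IH] k kjN // i; rewrite ltnS leq_eqVlt.
have {}kjN : (k.+1 + j <= N.+1)%N by rewrite addSnnS.
have Vk : vanish j (\tr (H w ^+ k.+1)) by apply: IH; apply: ltnW.
case/orP => [/eqP ->{i} | ij]; last exact: Vk.
case: j => [|j] in IH kjN Vk *.
  by apply: tr0; rewrite addn0 in kjN.
apply: (@mpoly_mulrnI _ _ j); rewrite mul0rn flow; last first.
  exact: leq_trans (leq_addl k _) kjN.
by rewrite IH // (vanish_gradform _ Vk) // mul0rn addr0 mul0rn.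
Qed.

End Flow.

(** * Matrix powers, and polynomials determined by their values *)

Lemma map_mx_exp (R1 R2 : nzRingType) (f : {rmorphism R1 -> R2}) n
    (M : 'M[R1]_n) k : map_mx f (M ^+ k) = map_mx f M ^+ k.
Proof.
elim: k => [|k IH]; first exact: map_mx1.
by rewrite !exprS -[M * _]/(M *m _) map_mxM IH.
Qed.

Lemma scale_mx_exp (R1 : comNzRingType) n (c : R1) (M : 'M[R1]_n) k :
  (c *: M) ^+ k = c ^+ k *: M ^+ k.
Proof.
elim: k => [|k IH]; first by rewrite !expr0 scale1r.
rewrite !exprS IH -[LHS]/(_ *m _) -[M * _]/(_ *m _).
by rewrite -scalemxAl -scalemxAr scalerA.
Qed.

Section Evaluation.
Variables (K : numFieldType) (n : nat).
Implicit Types (p : {mpoly K[n]}) (x : 'I_n -> K).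

Lemma mcoeff0_meval p : p@_0 = p.@[fun=> 0].
Proof.
rewrite {1}[p]mpolyE raddf_sum mevalE; apply: eq_bigr => m _ /=.
rewrite mcoeffZ mcoeffX; congr (_ * _).
have [-> | m_neq0] := eqVneq m 0%MM.
  by rewrite big1 // => i _; rewrite mnm0E expr0.
have [i mi] : exists i, m i != 0%N.
  apply/existsP; apply: contraR m_neq0; rewrite negb_exists => /forallP m0.
  by apply/eqP/mnmP => i; rewrite mnm0E; apply/eqP; have := m0 i; rewrite negbK.
by rewrite (bigD1 i) //= expr0n (negbTE mi) mul0r.
Qed.

Lemma horner_mmap (h : 'I_n -> {poly K}) p t :
  (mmap polyC h p).[t] = p.@[fun i => (h i).[t]].
Proof.
rewrite mevalE /mmap horner_sum; apply: eq_bigr => m _.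
rewrite hornerCM horner_prod; congr (_ * _).
by apply: eq_bigr => i _; rewrite horner_exp.
Qed.

(** The chain rule along the curve [h]: it holds for constants and variables and passes to sums and
    products. *)
Lemma deriv_mmap (h : 'I_n -> {poly K}) p :
  (mmap polyC h p)^`() = \sum_i (h i)^`() * mmap polyC h p^`M(i).
Proof.
pose chain q :=
  (mmap polyC h q)^`() = \sum_i (h i)^`() * mmap polyC h q^`M(i).
have chainC c : chain c%:MP.
  rewrite /chain mmapC derivC big1 // => i _.
  by rewrite mderivC mmap0 mulr0.
have chainM q r : chain q -> chain r -> chain (q * r).
  rewrite /chain rmorphM derivM => -> ->.
  rewrite mulr_suml mulr_sumr -big_split; apply: eq_bigr => i _ /=.
  by rewrite mderivM mmapD !rmorphM /=; ring.
have chainD q r : chain q -> chain r -> chain (q + r).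
  rewrite /chain mmapD derivD => -> ->; rewrite -big_split.
  by apply: eq_bigr => i _ /=; rewrite mderivD mmapD mulrDr.
have chainX i : chain 'X_i.
  rewrite /chain mmapX mmap1U (bigD1 i) //= big1 => [|j ji].
    by rewrite mderivX mnm1E eqxx scale1r -{1}[U_(i)%MM]add0m addmK mpolyX0 rmorph1 mulr1 addr0.
  by rewrite mderivX mnm1E eq_sym (negbTE ji) scale0r mmap0 mulr0.
rewrite -/(chain p) [p]mpolyE; apply: big_ind => [||m _] //.
  by rewrite -mpolyC0.
rewrite -mul_mpolyC; apply: (chainM) => //; rewrite mpolyXE_id.
apply: big_ind => [||i _] //; first by rewrite -mpolyC1.
by elim: (m i) => [|e IH]; rewrite ?expr0 -?mpolyC1 // exprS; apply: (chainM).
Qed.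

Lemma horner_eq0 (f : {poly K}) : (forall t, f.[t] = 0) -> f = 0.
Proof.
move=> f0; apply/eqP; apply: contraT => f_neq0.
(* In characteristic zero the integers below [size f] are distinct roots, one more than the degree
   allows. *)
have := @max_poly_roots _ f [seq i%:R | i <- iota 0 (size f)] f_neq0.
rewrite size_map size_iota ltnn => -> //.
  by apply/allP => _ /mapP[i _ ->]; rewrite /root f0.
rewrite map_inj_uniq ?iota_uniq // => i j /eqP.
by rewrite Num.Theory.eqr_nat => /eqP.
Qed.

Lemma meval_mderiv_eq0 p i :
  (forall x, p.@[x] = 0) -> forall x, p^`M(i).@[x] = 0.
Proof.
(* [h] is the line through [x] in direction [i]; its chain rule at [0] gives the partial derivative
   at [x]. *)
move=> p0 x; pose h j : {poly K} := (x j)%:P + (j == i)%:R%:P * 'X.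
have hp0 : mmap polyC h p = 0.
  by apply: horner_eq0 => t; rewrite horner_mmap.
have := congr1 (fun f : {poly K} => f.[0]) (deriv_mmap h p).
rewrite hp0 deriv0 horner0 horner_sum (bigD1 i) //= big1 => [|j ji].
  rewrite addr0 hornerM horner_mmap !derivE eqxx !hornerE => ->.
  by apply: meval_eq => j; rewrite !hornerE.
by rewrite !derivE (negbTE ji) !hornerE.
Qed.

(** Differentiation preserves vanishing everywhere and lowers the monomial, scaling its coefficient
    by a nonzero integer, until the coefficient is a value at the origin. *)
Lemma meval_eq0 p : (forall x, p.@[x] = 0) -> p = 0.
Proof.
move=> p0; apply/mpolyP => m; rewrite mcoeff0.
elim: {m}(mdeg m) {-2}m (erefl (mdeg m)) p p0 => [|e IH] m dm p p0.
  by move/eqP: dm; rewrite mdeg_eq0 => /eqP ->; rewrite mcoeff0_meval.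
have [i mi] : exists i, m i != 0%N.
  apply/existsP; apply: contraPT dm; rewrite negb_exists => /forallP m0.
  by rewrite mdegE big1 // => i _; have := m0 i; rewrite negbK => /eqP.
have Um : (U_(i) <= m)%MM.
  by apply/mnm_lepP => j; rewrite mnm1E; case: eqP => // <-; rewrite lt0n.
have dm' : mdeg (m - U_(i)) = e.
  by apply/eqP; rewrite -(eqn_add2r 1) -(mdeg1 i) -mdegD submK // dm mdeg1 addn1.
have /eqP := IH _ dm' _ (meval_mderiv_eq0 i p0).
by rewrite mcoeff_mderiv submK // Num.Theory.mulrn_eq0 => /eqP.
Qed.

End Evaluation.

(** * Directional derivatives of homogeneous polynomials *)

Section HomogeneousDerivatives.
Variables (K : numFieldType) (n : nat).
Implicit Types (p : {mpoly K[n]}) (b : 'rV[K]_n).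

Lemma dhomog_mderiv d p i : p \is d.+1.-homog -> p^`M(i) \is d.-homog.
Proof.
move=> hp; apply/dhomogP => m; rewrite mcoeff_msupp mcoeff_mderiv.
apply: contraNeq => md; rewrite (dhomog_nemf_coeff hp) ?mul0rn //.
by rewrite [X in X != _]mdegD mdeg1 addn1 eqSS.
Qed.

Lemma dhomog_dirderiv d p b : p \is d.+1.-homog -> dirderiv b p \is d.-homog.
Proof.
move=> hp; apply: rpred_sum => i _; apply: rpredZ.
exact: dhomog_mderiv.
Qed.

Lemma mderiv_dirderiv i b p : (dirderiv b p)^`M(i) = dirderiv b p^`M(i).
Proof.
rewrite raddf_sum; apply: eq_bigr => j _.
by rewrite /= mderivZ mderiv_comm.
Qed.

Lemma mderiv_iter_dirderiv i b e p :
  (iter e (dirderiv b) p)^`M(i) = iter e (dirderiv b) p^`M(i).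
Proof. by elim: e => //= e <-; rewrite mderiv_dirderiv. Qed.

(** Euler's identity at the point [b], checked on monomials. *)
Lemma meval_dirderiv d p b : p \is d.-homog ->
  (dirderiv b p).@[b 0] = d%:R * p.@[b 0].
Proof.
move=> hp; have euler m i :
    b 0 i * ('X_[m])^`M(i).@[b 0] = (m i)%:R * 'X_[m].@[b 0].
  rewrite mderivX mevalZ mulrCA; case: (m i =P 0%N) => [->|/eqP mi].
    by rewrite !mul0r.
  congr (_ * _); rewrite -(mevalXU (b 0) i) -mevalM -mpolyXD addmC submK //.
  by apply/mnm_lepP => j; rewrite mnm1E; case: eqP => // <-; rewrite lt0n.
have -> : dirderiv b p = \sum_(m <- msupp p) p@_m *: dirderiv b 'X_[m].
  rewrite /dirderiv; under [RHS]eq_bigr do rewrite scaler_sumr.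
  rewrite exchange_big; apply: eq_bigr => i _ /=.
  rewrite {1}[p]mpolyE (raddf_sum (mderiv i)) scaler_sumr.
  apply: eq_bigr => m _ /=.
  by rewrite mderivZ !scalerA mulrC.
rewrite [X in _ = _ * X.@[_]]mpolyE !raddf_sum mulr_sumr /=.
rewrite big_seq [RHS]big_seq; apply: eq_bigr => m mp.
rewrite !mevalZ mulrCA; congr (_ * _); rewrite /dirderiv raddf_sum /=.
under eq_bigr => i _ do rewrite mevalZ euler.
by rewrite -mulr_suml -natr_sum -mdegE (dhomog_mf hp mp).
Qed.

(** Each derivative lowers the degree by one, and Euler's identity supplies the factors of [e!]. *)
Lemma iter_dirderiv_dhomog e p b : p \is e.-homog ->
  iter e (dirderiv b) p = (e`!%:R * p.@[b 0])%:MP.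
Proof.
elim: e p => [|e IH] p hp.
  have pC : p = (p@_0)%:MP.
    apply/mpolyP => m; rewrite mcoeffC eq_sym.
    have [-> | m0] := eqVneq m 0%MM; first by rewrite mulr1.
    by rewrite mulr0 (dhomog_nemf_coeff hp) // mdeg_eq0.
  by rewrite fact0 mul1r /= {2}pC mevalC -pC.
rewrite iterSr IH ?dhomog_dirderiv // (meval_dirderiv _ hp) factS natrM.
by rewrite mulrCA mulrA.
Qed.

End HomogeneousDerivatives.

(** * The trace criterion and its transfer to directional derivatives *)

Section HessianCriterion.
Variables (K : numFieldType) (n : nat) (A : 'M[K]_n).
Hypothesis A_sym : A^T = A.

Definition hessian_at (p : {mpoly K[n]}) (x : 'I_n -> K) : 'M[K]_n :=
  \matrix_(i, j) p^`M(j)^`M(i).@[x].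

Lemma laplacian_nilpotent_trace (p : {mpoly K[n]}) :
  laplacian_nilpotent A p <->
  (forall x k, \tr ((A *m hessian_at p x) ^+ k.+1) = 0).
Proof.
have tr_flow (w : {poly {mpoly K[n]}}) k : w`_0 = p ->
    (\tr ((Apoly A *m hess (@cmderiv K n) w) ^+ k.+1))`_0 = 0 <->
    (forall x, \tr ((A *m hessian_at p x) ^+ k.+1) = 0).
  move=> w0; set t := \tr _.
  (* Setting [s = 0] and evaluating at [x] are ring morphisms, so they commute with products and
     traces. *)
  have t0 x : (t`_0).@[x] = \tr ((A *m hessian_at p x) ^+ k.+1).
    rewrite -horner_coef0 -[t.[0]]/(horner_eval 0 t) /t -!trace_map_mx.
    rewrite !map_mx_exp !map_mxM; congr (\tr ((_ *m _) ^+ _)).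
      by apply/matrixP => i j; rewrite !mxE /= /horner_eval hornerC mevalC.
    apply/matrixP => i j; rewrite !mxE /= /horner_eval horner_coef0.
    by rewrite !coef_map /= w0.
  by split=> [eq0 x | eq0]; [rewrite -t0 eq0 meval0
                            | apply: meval_eq0 => x; rewrite t0].
split=> [nilp x k | tr0 [//|m] _].
  (* A flow of order [k] already controls the power [k.+1]. *)
  have [w [w0 VE]] := exists_flow A_sym k p.
  apply: (proj1 (tr_flow w k w0)).
  apply: (proj1 (vanish_lap_flow A_sym VE)) (leqnn k).
  apply: (proj1 (laplacian_nilpotent_flow w0 VE)) => j _; exact: nilp.
have [w [w0 VE]] := exists_flow A_sym m p.
apply: (proj2 (laplacian_nilpotent_flow w0 VE)) (leqnn m).
apply: (proj2 (vanish_lap_flow A_sym VE)) => k _.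
by apply: (proj2 (tr_flow w k w0)) => x; apply: tr0.
Qed.

Lemma hessian_at_iter_dirderiv d p b x : p \is d.+2.-homog ->
  hessian_at (iter d (dirderiv b) p) x = d`!%:R *: hessian_at p (b 0).
Proof.
move=> hp; apply/matrixP => i j; rewrite !mxE !mderiv_iter_dirderiv.
by rewrite iter_dirderiv_dhomog ?mevalC //; do 2 apply: dhomog_mderiv.
Qed.

Lemma laplacian_nilpotent_iter_dirderiv d p : p \is d.+2.-homog ->
  laplacian_nilpotent A p <->
  (forall b : 'rV[K]_n, laplacian_nilpotent A (iter d (dirderiv b) p)).
Proof.
move=> hp.
have trQ b x k : \tr ((A *m hessian_at (iter d (dirderiv b) p) x) ^+ k.+1) =
    d`!%:R ^+ k.+1 * \tr ((A *m hessian_at p (b 0)) ^+ k.+1).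
  by rewrite hessian_at_iter_dirderiv // -scalemxAr scale_mx_exp mxtraceZ.
split=> [/laplacian_nilpotent_trace trP b | nilQ].
  by apply/laplacian_nilpotent_trace => x k; rewrite trQ trP mulr0.
apply/laplacian_nilpotent_trace => x k.
(* The direction is chosen as the point [x] itself; the factor [d!^(k+1)] is nonzero and cancels. *)
have /laplacian_nilpotent_trace/(_ x k)/eqP := nilQ (\row_i x i).
rewrite trQ mulf_eq0 expf_eq0 /= Num.Theory.pnatr_eq0 eqn0Ngt fact_gt0 /=.
suff -> : hessian_at p ((\row_i x i) 0) = hessian_at p x by move/eqP.
apply/matrixP => i j; rewrite !mxE; apply: meval_eq => l.
by rewrite mxE.
Qed.

End HessianCriterion.

Unset Implicit Arguments.

Theorem proposition3p7 (R : realType) (n : nat) (A : 'M[R[i]]_n)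
    (hA : A \in unitmx) (hAsym : A^T = A)
    (d : nat) (hd : (2 <= d)%N)
    (P : {mpoly R[i][n]}) (hP : P \is d.-homog) :
  laplacian_nilpotent A P <->
  (forall b : 'rV[R[i]]_n,
     laplacian_nilpotent A (iter (d - 2) (dirderiv b) P)).
Proof.
case: d hd hP => [//|[//|d]] _ hP; rewrite !subSS subn0.
exact: laplacian_nilpotent_iter_dirderiv.
Qed.
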